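(* Every family $\{h_j:j\in J\}$ of functions $h_j:A\to A$ on a set $A$ (with $J$ an index set) admits a minimal injective non-commutative dilation.
   Context: $\mathbb{N}=\{1,2,\ldots\}$, $\mathbb{Z}_+=\{0,1,2,\ldots\}$. Let $J$ be an index set and $\{h_j:j\in J\}$ a family of functions on a set $A$. A quadruple $(B,i,(v_j)_{j\in J},p)$ is an injective non-commutative dilation of $\{h_j:j\in J\}$ if $B$ is a set, $i:A\to B$ is an injective function, for every $j\in J$ the map $v_j:B\to B$ is injective, $v_j(B)\cap v_k(B)=\emptyset$ for $j\neq k$, $p:B\to B$ is an idempotent ($p\circ p=p$) with $p(B)=i(A)$, and $$i(h_{j_1}h_{j_2}\cdots h_{j_k}(a))=p(v_{j_1}v_{j_2}\cdots v_{j_k}(i(a)))$$ for all $j_1,\ldots,j_k\in J$, $k\in\mathbb{N}$, $a\in A$. It is minimal if $B=\{v_{j_1}v_{j_2}\cdots v_{j_k}(i(a)):j_1,\ldots,j_k\in J,\ k\in\mathbb{Z}_+,\ a\in A\}$ (the empty composition, $k=0$, being the identity). *)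

(* Defs.v *)
From mathcomp Require Import all_boot.
From mathcomp Require Import classical_sets.

Set Implicit Arguments.
Unset Strict Implicit.
Unset Printing Implicit Defensive.

Local Open Scope classical_set_scope.

(* [word_app f [:: j1; ...; jk] x] is f_{j1} (f_{j2} (... (f_{jk} x))). *)
Definition word_app (J X : Type) (f : J -> X -> X) (w : seq J) (x : X) : X :=
  foldr f x w.

Record injective_nc_dilation (J A : Type) (h : J -> A -> A)
    (B : Type) (i : A -> B) (v : J -> B -> B) (p : B -> B) : Prop := {
  dil_i_inj : injective i;
  dil_v_inj : forall j : J, injective (v j);
  dil_v_disj : forall j k : J, j <> k -> range (v j) `&` range (v k) = set0;
  dil_p_idem : p \o p = p;
  dil_p_range : range p = range i;
  dil_compress : forall (w : seq J) (a : A), (0 < size w)%N ->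
    i (word_app h w a) = p (word_app v w (i a)) }.

Definition minimal_dilation (J A B : Type) (i : A -> B) (v : J -> B -> B) : Prop :=
  [set: B] = [set b | exists (w : seq J) (a : A), b = word_app v w (i a)].

(* Main.v *)
Require Import Defs.
From mathcomp Require Import all_boot.
From mathcomp Require Import boolp classical_sets.

Set Implicit Arguments.
Unset Strict Implicit.

(** The dilation lives on the free object [seq J * A]: a pair [(w, a)] is the
    formal, unevaluated application of the word [w] to the point [a].  The map
    attached to [j] prepends the letter [j], so injectivity and disjointness of
    ranges are exactly unique decomposition of a nonempty word into head and
    tail.  The idempotent evaluates the formal application by means of [h] and
    stores the result under the empty word, where evaluating again changes
    nothing.  Words acting on [([::], a)] rebuild themselves
    ([word_app_formal_apply]); this gives both minimality and the compression
    identity. *)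

Definition formal_point (J A : Type) (a : A) : seq J * A := ([::], a).

Definition formal_apply (J A : Type) (j : J) (x : seq J * A) : seq J * A :=
  (j :: x.1, x.2).

Definition formal_eval (J A : Type) (h : J -> A -> A) (x : seq J * A) :
    seq J * A :=
  @formal_point J A (word_app h x.1 x.2).

Lemma word_app_formal_apply (J A : Type) (w : seq J) (a : A) :
  word_app (@formal_apply J A) w (@formal_point J A a) = (w, a).
Proof. by elim: w => //= j w ->. Qed.

Theorem theorem2p7 (J A : Type) (h : J -> A -> A) :
  exists (B : Type) (i : A -> B) (v : J -> B -> B) (p : B -> B),
    injective_nc_dilation h i v p /\ minimal_dilation i v.
Proof.
exists (seq J * A)%type, (@formal_point J A), (@formal_apply J A), (@formal_eval J A h).
split; first split.
- by move=> a b [].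
- by move=> j [w a] [w' a'] [-> ->].
- move=> j k neq_jk; rewrite -subset0 => _ [[x _ <-] [y _ [eq_kj _ _]]].
  exact/neq_jk/esym.
- exact: funext.
- apply/seteqP; split=> [_ [x _ <-]|_ [a _ <-]].
    by exists (word_app h x.1 x.2).
  by exists (@formal_point J A a).
- by move=> w a _; rewrite word_app_formal_apply.
- apply/seteqP; split=> // -[w a] _.
  by exists w, a; rewrite word_app_formal_apply.
Qed.
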